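(* Let $K$ be a nonnegative integer and $\rho>0$. Then the stationary blocking probability of the symmetric join-the-shortest-queue system with two queues of capacity $K$ is $$\pi_K(K,K)=\begin{cases}\dfrac{(1-\rho)(2-\rho)}{\rho^{-2K}+(1-\rho)(2\rho)^{-K}-\rho(2-\rho)} & \text{if } \rho\notin\{1,2\},\\[2mm] \left(2K+2^{-K}\right)^{-1} & \text{if } \rho=1,\\[1mm] \left(2-(K+2)2^{-(2K+1)}\right)^{-1} & \text{if } \rho=2,\end{cases}$$ or equivalently, for all $\rho>0$, $$\pi_K(K,K)=\frac{2\rho^{2K}}{2\sum_{k=0}^{2K}\rho^k-\sum_{k=0}^{K-1}(\rho/2)^k}.$$
   Context: Symmetric finite-capacity JSQ model: two one-server queues, each of capacity $K$; service times are exponential with parameter $1$ at both queues; customers arrive according to a Poisson process with parameter $2\rho$ and join the shortest queue, or either queue with probability $1/2$ if both lengths are equal; when both queues have length $K$ arriving customers are lost. The queue-length process $(L_1(t),L_2(t))_{t\ge0}$ is the continuous-time Markov chain on $\{0,\dots,K\}^2$ with the following transition rates ($e_1,e_2$ the unit vectors). From $(k,k)$: to $(k,k)+e_1$ and to $(k,k)+e_2$ at rate $\rho$ each if $k<K$; to $(k,k)-e_1$ and to $(k,k)-e_2$ at rate $1$ each if $k>0$. From $(j,k)$ with $j<k$: to $(j+1,k)$ at rate $2\rho$, to $(j-1,k)$ at rate $1$ if $j>0$, to $(j,k-1)$ at rate $1$. From $(k,j)$ with $j<k$: to $(k,j+1)$ at rate $2\rho$, to $(k,j-1)$ at rate $1$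 if $j>0$, to $(k-1,j)$ at rate $1$. The chain is irreducible, and $\pi_K$ denotes its unique invariant probability distribution. An empty sum is $0$. *)

(* Defs.v *)
From HB Require Import structures.
From mathcomp Require Import all_boot all_order all_algebra.
From mathcomp Require Import reals.

Set Implicit Arguments.
Unset Strict Implicit.
Unset Printing Implicit Defensive.

Import Order.TTheory GRing.Theory Num.Theory.
Local Open Scope ring_scope.

(* Generator of the continuous-time Markov chain with jump rates [q]; the
   diagonal values [q x x] are irrelevant. *)
Definition generator (R : realType) (S : finType) (q : S -> S -> R) (x y : S)
    : R :=
  if x == y then - \sum_(z | z != x) q x z else q x y.

Definition invariant_distribution (R : realType) (S : finType)
    (q : S -> S -> R) (p : S -> R) : Prop :=
  [/\ forall x, 0 <= p x,
      \sum_x p x = 1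
    & forall y, \sum_x p x * generator q x y = 0].

Definition jsq_state (K : nat) : finType := ('I_K.+1 * 'I_K.+1)%type.

(* Once the guards on [0 < a] and [0 < b] are taken into account, the targets
   listed in each of the three cases are pairwise distinct, so the order of the
   tests is irrelevant. *)
Definition jsq_rate (R : realType) (K : nat) (rho : R) (x y : jsq_state K)
    : R :=
  let: (a, b) := (x.1 : nat, x.2 : nat) in
  let y' := (y.1 : nat, y.2 : nat) in
  if (a == b)%N then
    if (a < K)%N && ((y' == (a.+1, b)) || (y' == (a, b.+1))) then rho
    else if (0 < a)%N && ((y' == (a.-1, b)) || (y' == (a, b.-1))) then 1
    else 0
  else if (a < b)%N then
    if y' == (a.+1, b) then 2 * rho
    else if (0 < a)%N && (y' == (a.-1, b)) then 1
    else if y' == (a, b.-1) then 1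
    else 0
  else
    if y' == (a, b.+1) then 2 * rho
    else if (0 < b)%N && (y' == (a, b.-1)) then 1
    else if y' == (a.-1, b) then 1
    else 0.

(* Main.v *)
(* For a function F of the state, invariance says that the average of the drift
   (generator applied to F) under pi_K vanishes. Since the maximum of the two
   queue lengths increases from k only in the state (k, k), a Poisson equation with
   constant drift c off (K, K) has a solution f(min, max) that does not depend
   on K: the drift condition at (K, K) is the one of a larger system, minus the
   term 2 * rho * (f K K.+1 - f K K) of the arrivals that are lost. Averaging
   yields pi_K(K, K) * 2 * rho * (f K K.+1 - f K K) = c, so an explicit f gives
   the blocking probability. *)

Require Import Defs.
From HB Require Import structures.
From mathcomp Require Import all_boot all_order all_algebra.
From mathcomp Require Import reals.
From mathcomp Require Import zify ring lra.

Set Implicit Arguments.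
Unset Strict Implicit.
Unset Printing Implicit Defensive.

Import Order.TTheory GRing.Theory Num.Theory.
Local Open Scope ring_scope.

(** * Generators and vanishing mean drift *)

Lemma sum_generator (R : realType) (S : finType) (q : S -> S -> R)
    (F : S -> R) (x : S) :
  \sum_y generator q x y * F y = \sum_y q x y * (F y - F x).
Proof.
rewrite (bigD1 x) //= /generator eqxx [RHS](bigD1 x) //= subrr mulr0 add0r.
rewrite mulNr mulr_suml -sumrN -big_split /=; apply: eq_bigr => y yx.
by rewrite eq_sym (negbTE yx) mulrBr addrC.
Qed.

Lemma invariant_generator0 (R : realType) (S : finType) (q : S -> S -> R)
    (p F : S -> R) :
  invariant_distribution q p ->
  \sum_x p x * \sum_y q x y * (F y - F x) = 0.
Proof.
move=> [_ _ inv_p].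
under eq_bigr => x _ do rewrite -sum_generator mulr_sumr.
rewrite exchange_big big1 //= => y _.
by under eq_bigr => x _ do rewrite mulrA; rewrite -mulr_suml inv_p mul0r.
Qed.

(** Spreads one value of [G] over all states, so that an expected drift can be compared with a row
    of [jsq_rate] summand by summand. *)
Lemma sum_jsq_state_pred1 (R : realType) (K a b : nat) (G : nat -> nat -> R) :
  (a <= K)%N -> (b <= K)%N ->
  \sum_(y : jsq_state K) ((y.1 == a :> nat) && (y.2 == b :> nat))%:R *
    G y.1 y.2 = G a b.
Proof.
move=> aK bK; rewrite (bigD1 (inord a, inord b)) //= !inordK // !eqxx mul1r.
rewrite big1 ?addr0 // => -[c d] /= /negbTE; rewrite xpair_eqE.
by rewrite -!val_eqE /= !inordK // => ->; rewrite mul0r.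
Qed.

(** * Drift of a symmetric test function *)

Section TestFunction.

Variables (R : realType) (K : nat) (rho c : R) (f : nat -> nat -> R).
(** Since [0.-1] is [0], a departure from an empty queue has increment zero, so one equation covers
    the boundary [m = 0] too. *)
Hypothesis f_off_diag : forall m n, (m < n)%N ->
  2 * rho * (f m.+1 n - f m n) + (f m.-1 n - f m n) + (f m n.-1 - f m n) = c.
Hypothesis f_diag : forall n,
  2 * rho * (f n n.+1 - f n n) + 2 * (f n.-1 n - f n n) = c.

Let F (a b : nat) : R := f (minn a b) (maxn a b).

Let Flt m n : (m <= n)%N -> F m n = f m n.
Proof. by move=> mn; rewrite /F (minn_idPl mn) (maxn_idPr mn). Qed.

Let Fgt m n : (m <= n)%N -> F n m = f m n.
Proof. by move=> mn; rewrite /F (minn_idPr mn) (maxn_idPl mn). Qed.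

Let drift_lt (x : jsq_state K) : (x.1 < x.2)%N ->
  \sum_y jsq_rate rho x y * (F y.1 y.2 - F x.1 x.2) = c.
Proof.
case: x => -[a aK] [b bK] /= ab.
pose G u v := F u v - F a b.
transitivity (2 * rho * G a.+1 b + G a.-1 b + G a b.-1).
  rewrite -(@sum_jsq_state_pred1 _ K a.+1 b G); [|lia|lia].
  rewrite -(@sum_jsq_state_pred1 _ K a.-1 b G); [|lia|lia].
  rewrite -(@sum_jsq_state_pred1 _ K a b.-1 G); [|lia|lia].
  rewrite mulr_sumr -!big_split; apply: eq_bigr => -[[u uK] [v vK]] _ /=.
  rewrite /jsq_rate /= ltn_eqF // ab !xpair_eqE -/(G u v).
  case: (u =P a.+1) => [ua|?]; case: (v =P b) => [vb|?];
    case: (u =P a.-1) => [ua'|?]; case: (v =P b.-1) => [vb'|?];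
    case: (u =P a) => [ua''|?]; case: (posnP a) => a0 /=; try lia; try ring;
  (* The remaining cases have [a = 0]: the jump to [a.-1] stays in place and its increment
     vanishes. *)
  by rewrite ua'' vb /G subrr !mulr0 !addr0.
rewrite /G !Flt; try lia.
by rewrite -(f_off_diag ab).
Qed.

Let drift_gt (x : jsq_state K) : (x.2 < x.1)%N ->
  \sum_y jsq_rate rho x y * (F y.1 y.2 - F x.1 x.2) = c.
Proof.
case: x => -[b bK] [a aK] /= ab.
pose G u v := F u v - F b a.
transitivity (2 * rho * G b a.+1 + G b a.-1 + G b.-1 a).
  rewrite -(@sum_jsq_state_pred1 _ K b a.+1 G); [|lia|lia].
  rewrite -(@sum_jsq_state_pred1 _ K b a.-1 G); [|lia|lia].
  rewrite -(@sum_jsq_state_pred1 _ K b.-1 a G); [|lia|lia].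
  rewrite mulr_sumr -!big_split; apply: eq_bigr => -[[v vK] [u uK]] _ /=.
  rewrite /jsq_rate /= gtn_eqF // ltnNge ltnW //= !xpair_eqE -/(G v u).
  case: (u =P a.+1) => [ua|?]; case: (v =P b) => [vb|?];
    case: (u =P a.-1) => [ua'|?]; case: (v =P b.-1) => [vb'|?];
    case: (u =P a) => [ua''|?]; case: (posnP a) => a0 /=; try lia; try ring;
  by rewrite ua'' vb /G subrr !mulr0 !addr0.
rewrite /G !Fgt; try lia.
by rewrite -(f_off_diag ab).
Qed.

Let drift_diag (x : jsq_state K) : x.1 = x.2 :> nat ->
  \sum_y jsq_rate rho x y * (F y.1 y.2 - F x.1 x.2) =
  c - (x == (ord_max, ord_max))%:R * (2 * rho * (f K K.+1 - f K K)).
Proof.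
case: x => -[a aK] [b bK] /= ab; move: bK; rewrite -{b}ab => bK.
rewrite xpair_eqE -!val_eqE /= andbb.
pose G u v := F u v - F a a.
transitivity
  ((a < K)%:R * (2 * rho * (f a a.+1 - f a a)) + G a.-1 a + G a a.-1).
  (* By symmetry of [F] the two arrivals, each at rate [rho], have equal increments. For [a = K]
     their targets are not states, and the factor [(a < K)%:R] removes them. *)
  have -> : (a < K)%:R * (2 * rho * (f a a.+1 - f a a)) =
     (a < K)%:R * rho * (\sum_(y : jsq_state K)
       ((y.1 == a.+1 :> nat) && (y.2 == a :> nat))%:R * G y.1 y.2 +
     \sum_(y : jsq_state K)
       ((y.1 == a :> nat) && (y.2 == a.+1 :> nat))%:R * G y.1 y.2).
    case: (ltnP a K) => aK'; last by rewrite !mul0r.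
    rewrite !sum_jsq_state_pred1; try lia.
    rewrite /G (Fgt (leqnSn a)) (Flt (leqnSn a)) (Flt (leqnn a)); ring.
  rewrite -(@sum_jsq_state_pred1 _ K a.-1 a G); [|lia|lia].
  rewrite -(@sum_jsq_state_pred1 _ K a a.-1 G); [|lia|lia].
  rewrite -big_split mulr_sumr -!big_split.
  apply: eq_bigr => -[[u uK] [v vK]] _ /=.
  rewrite /jsq_rate /= eqxx !xpair_eqE -/(G u v).
  case: (ltnP a K) => aK'; case: (u =P a.+1) => [ua|?];
    case: (u =P a) => [ua''|?]; case: (u =P a.-1) => [ua'|?];
    case: (v =P a.+1) => [va|?]; case: (v =P a) => [va''|?];
    case: (v =P a.-1) => [va'|?]; case: (posnP a) => a0 /=;
    try lia; try ring;
  by rewrite ua'' va'' /G subrr !(mulr0, addr0).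
rewrite /G (Flt (leq_pred a)) (Fgt (leq_pred a)) (Flt (leqnn a)).
by rewrite -(f_diag a); case: (ltngtP a K) => [?|?|->] /=; [ring|lia|ring].
Qed.

Lemma invariant_test_function (p : jsq_state K -> R) :
  invariant_distribution (@jsq_rate R K rho) p ->
  p (ord_max, ord_max) * (2 * rho * (f K K.+1 - f K K)) = c.
Proof.
move=> inv_p.
have := invariant_generator0 (fun x : jsq_state K => F x.1 x.2) inv_p.
have drift (x : jsq_state K) :
    \sum_y jsq_rate rho x y * (F y.1 y.2 - F x.1 x.2) =
    c - (x == (ord_max, ord_max))%:R * (2 * rho * (f K K.+1 - f K K)).
  case: (ltngtP x.1 x.2) => [lt12|gt12|]; last exact: drift_diag.
    rewrite drift_lt //; case: eqP lt12 => [->|_ _]; rewrite ?ltnn //=; ring.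
  rewrite drift_gt //; case: eqP gt12 => [->|_ _]; rewrite ?ltnn //=; ring.
under eq_bigr => x _ do rewrite drift mulrBr.
have [_ p1 _] := inv_p.
rewrite sumrB -mulr_suml p1 mul1r (bigD1 (ord_max, ord_max)) //= eqxx mul1r.
rewrite [X in _ - (_ + X)]big1 ?addr0 => [|x /negbTE ->]; last first.
  by rewrite mul0r mulr0.
by move/subr0_eq.
Qed.

End TestFunction.

(** * Geometric sums and explicit test functions *)

Lemma sum_geometric (R : nzRingType) (x : R) n :
  (1 - x) * (\sum_(0 <= k < n) x ^+ k) = 1 - x ^+ n.
Proof. by rewrite big_mkord -opprB mulNr -subrX1 opprB. Qed.

(** Both sides vanish at [rho = 1] and at [rho = 2], so these two values require test functions of
    their own. *)
Lemma jsq_blocking_generic (R : realType) K (rho : R) (p : jsq_state K -> R) :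
  0 < rho -> invariant_distribution (@jsq_rate R K rho) p ->
  p (ord_max, ord_max) * (2 * (1 - rho) *
    (rho ^- (2 * K) + (1 - rho) * (2 * rho) ^- K - rho * (2 - rho))) =
  2 * (1 - rho) * ((1 - rho) * (2 - rho)).
Proof.
move=> rho0 inv_p; have rhoN0 : rho != 0 by rewrite gt_eqF.
have rhoX k : rho ^+ k != 0 by rewrite expf_neq0.
have twoX k : (2 : R) ^+ k != 0 by rewrite expf_neq0 ?pnatr_eq0.
(* The first summand has zero drift off the diagonal, being the combination of
   the exponentials x ^ m * y ^ n with y = 1 / rho and x = 1 / rho, 1 / 2 that
   respects the boundary m = 0; the second one has constant drift there, and
   makes up for the drift of the first one on the diagonal. *)
pose f m n := rho ^- n * (rho ^- m + (1 - rho) * 2 ^- m) -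
  (1 - rho) * (2 - rho) * (n%:R + \sum_(k < m) (1 - (2 * rho) ^- k.+1)).
have f_off m n : (m < n)%N -> 2 * rho * (f m.+1 n - f m n) +
    (f m.-1 n - f m n) + (f m n.-1 - f m n) =
    2 * (1 - rho) * ((1 - rho) * (2 - rho)).
  case: n => // n _; rewrite /f; case: m => [|m] /=.
    rewrite big_ord1 big_ord0 !exprMn !exprS expr0 -natr1; field.
    by rewrite ?add0r !(rhoX, rhoN0).
  rewrite !big_ord_recr /= !exprMn !exprS -!natr1; field.
  by rewrite ?add0r !(rhoX, rhoN0, twoX).
have f_diag n : 2 * rho * (f n n.+1 - f n n) + 2 * (f n.-1 n - f n n) =
    2 * (1 - rho) * ((1 - rho) * (2 - rho)).
  rewrite /f; case: n => [|n] /=.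
    by rewrite big_ord0 !exprS expr0; field.
  rewrite !big_ord_recr /= !exprMn !exprS -!natr1; field.
  by rewrite ?add0r !(rhoX, rhoN0, twoX).
rewrite -(invariant_test_function f_off f_diag inv_p); congr (_ * _).
rewrite /f mul2n -addnn exprD !exprMn !exprS -!natr1; field.
by rewrite ?add0r !(rhoX, rhoN0, twoX).
Qed.

Lemma jsq_blocking1 (R : realType) K (p : jsq_state K -> R) :
  invariant_distribution (@jsq_rate R K 1) p ->
  p (ord_max, ord_max) * (2 * K%:R + 2 ^- K) = 1.
Proof.
move=> inv_p.
have twoX k : (2 : R) ^+ k != 0 by rewrite expf_neq0 ?pnatr_eq0.
(* The limit as rho -> 1 of the test function of [jsq_blocking_generic], minus
   a constant depending on rho, divided by (1 - rho) ^ 2 * (2 - rho). *)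
pose f m n : R := (n%:R + m%:R) * (n%:R + m%:R - 1) / 2 +
  (n%:R - m%:R - 3) * 2 ^- m.
have f_off m n : (m < n)%N -> 2 * 1 * (f m.+1 n - f m n) +
    (f m.-1 n - f m n) + (f m n.-1 - f m n) = 2.
  case: n => // n _; rewrite /f; case: m => [|m] /=.
    by rewrite expr1 expr0 -!natr1; field.
  by rewrite !exprS -!natr1; field; rewrite ?add0r !twoX.
have f_diag n : 2 * 1 * (f n n.+1 - f n n) + 2 * (f n.-1 n - f n n) = 2.
  rewrite /f; case: n => [|n] /=; first by rewrite expr0; field.
  by rewrite !exprS -!natr1; field; rewrite ?add0r !twoX.
apply: (mulfI (_ : 2 != 0 :> R)); first by rewrite pnatr_eq0.
rewrite mulr1 -[RHS](invariant_test_function f_off f_diag inv_p) /f -natr1.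
by field; rewrite ?add0r !twoX.
Qed.

Lemma jsq_blocking2 (R : realType) K (p : jsq_state K -> R) :
  invariant_distribution (@jsq_rate R K 2) p ->
  p (ord_max, ord_max) * (2 - (K%:R + 2) * 2 ^- (2 * K + 1)) = 1.
Proof.
move=> inv_p.
have twoX k : (2 : R) ^+ k != 0 by rewrite expf_neq0 ?pnatr_eq0.
(* The limit as rho -> 2 of the test function of [jsq_blocking_generic], minus
   a constant depending on rho, divided by (2 - rho) / 2. *)
pose f m n : R := (m%:R + 2) * 2 ^- n * 2 ^- m +
  2 * (n%:R + m%:R + (2 ^- m) ^+ 2 / 3).
have f_off m n : (m < n)%N -> 2 * 2 * (f m.+1 n - f m n) +
    (f m.-1 n - f m n) + (f m n.-1 - f m n) = 4.
  case: n => // n _; rewrite /f; case: m => [|m] /=.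
    by rewrite expr1 expr0 !exprS -!natr1; field; rewrite ?add0r !twoX.
  by rewrite !exprS -!natr1; field; rewrite ?add0r !twoX.
have f_diag n : 2 * 2 * (f n n.+1 - f n n) + 2 * (f n.-1 n - f n n) = 4.
  rewrite /f; case: n => [|n] /=; first by rewrite expr1 expr0; field.
  by rewrite !exprS -!natr1; field; rewrite ?add0r !twoX.
apply: (mulfI (_ : 4 != 0 :> R)); first by rewrite pnatr_eq0.
rewrite mulr1 -[RHS](invariant_test_function f_off f_diag inv_p) /f -natr1.
by rewrite mul2n -addnn addn1 !exprS exprD; field; rewrite ?add0r !twoX.
Qed.

(** * Closed forms and the formula with sums *)

Theorem theorem1 (R : realType) (K : nat) (rho : R) (hrho : 0 < rho)
    (p : jsq_state K -> R)
    (hp : invariant_distribution (@jsq_rate R K rho) p) :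
  [/\ rho <> 1 -> rho <> 2 ->
        p (ord_max, ord_max) =
          (1 - rho) * (2 - rho) /
          (rho ^- (2 * K) + (1 - rho) * (2 * rho) ^- K - rho * (2 - rho)),
      rho = 1 ->
        p (ord_max, ord_max) = (2 * K%:R + 2 ^- K)^-1,
      rho = 2 ->
        p (ord_max, ord_max) = (2 - (K%:R + 2) * 2 ^- (2 * K + 1))^-1
    & p (ord_max, ord_max) =
        2 * rho ^+ (2 * K) /
        (2 * (\sum_(0 <= k < (2 * K).+1) rho ^+ k)
           - \sum_(0 <= k < K) (rho / 2) ^+ k)].
Proof.
(* No denominator has to be studied directly: it is a factor of a nonzero product, hence nonzero. *)
have unmul (x D c : R) : c != 0 -> x * D = c -> x = c / D.
  move=> cN0 xD; have DN0 : D != 0.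
    by apply: contraNneq cN0 => D0; rewrite -xD D0 mulr0.
  by rewrite -xD mulfK.
have rhoN0 : rho != 0 by rewrite gt_eqF.
have rhoX k : rho ^+ k != 0 by rewrite expf_neq0.
have twoX k : (2 : R) ^+ k != 0 by rewrite expf_neq0 ?pnatr_eq0.
have generic : rho <> 1 -> p (ord_max, ord_max) *
    (rho ^- (2 * K) + (1 - rho) * (2 * rho) ^- K - rho * (2 - rho)) =
    (1 - rho) * (2 - rho).
  move=> /eqP rho1; apply: (mulfI (_ : 2 * (1 - rho) != 0)).
    by rewrite mulf_neq0 ?pnatr_eq0 // subr_eq0 eq_sym.
  by rewrite -(jsq_blocking_generic hrho hp) mulrCA.
split.
- move=> rho1 /eqP rho2; apply: unmul; last exact: generic.
  by rewrite mulf_neq0 // subr_eq0 eq_sym //; apply/eqP.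
- move=> rho1; subst rho; rewrite -[RHS]mul1r.
  apply: unmul; first exact: oner_neq0.
  exact: jsq_blocking1 hp.
- move=> rho2; subst rho; rewrite -[RHS]mul1r.
  apply: unmul; first exact: oner_neq0.
  exact: jsq_blocking2 hp.
apply: unmul; first by rewrite mulf_neq0 ?pnatr_eq0.
have [rho1|/eqP rho1] := eqVneq rho 1.
  subst rho.
  (* At [rho = 1] the two sums are [2 * K + 1] and [2 * (1 - 2 ^- K)]. *)
  rewrite [X in _ * X](_ : _ = 2 * 1 ^+ (2 * K) * (2 * K%:R + 2 ^- K)).
    by rewrite mulrCA (jsq_blocking1 hp) mulr1.
  have := sum_geometric (2^-1 : R) K; rewrite exprVn => geo.
  under eq_bigr => k _ do rewrite expr1n.
  rewrite sumr_const_nat subn0 -(natr1 (2 * K)) natrM expr1n div1r.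
  lra.
have [rho2|/eqP rho2] := eqVneq rho 2.
  subst rho; rewrite [X in _ * X](_ : _ = 2 * 2 ^+ (2 * K) *
      (2 - (K%:R + 2) * 2 ^- (2 * K + 1))).
    by rewrite mulrCA (jsq_blocking2 hp) mulr1.
  have := sum_geometric (2 : R) (2 * K).+1; rewrite divff ?pnatr_eq0 // => geo.
  under [X in _ - X]eq_bigr => k _ do rewrite expr1n.
  rewrite sumr_const_nat subn0.
  have -> : \sum_(0 <= k < (2 * K).+1) 2 ^+ k = 2 * 2 ^+ (2 * K) - 1 :> R.
    by rewrite exprS in geo; lra.
  by rewrite addn1 exprS; field; rewrite ?add0r !twoX.
(* This factor clears both geometric sums, because 2 - rho = 2 * (1 - rho / 2). On the right,
   [generic] turns it into a multiple of the blocking probability, which leaves an identity in [rho]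
   and [K] alone. *)
apply: (mulfI (_ : (1 - rho) * (2 - rho) != 0)).
  by rewrite mulf_neq0 // subr_eq0 eq_sym; apply/eqP.
rewrite -[in RHS](generic rho1) mulrCA -[RHS]mulrA; congr (_ * _).
rewrite mulrBr [_ * (2 * _)](_ : _ = 2 * (2 - rho) *
  ((1 - rho) * \sum_(0 <= k < (2 * K).+1) rho ^+ k)); last by ring.
rewrite [X in _ - X](_ : _ = 2 * (1 - rho) *
  ((1 - rho / 2) * \sum_(0 <= k < K) (rho / 2) ^+ k)); last by field.
rewrite !sum_geometric exprS exprMn exprVn mul2n -addnn exprD exprMn; field.
by rewrite ?add0r !(rhoX, twoX).
Qed.
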